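(* Let $G=(V,E)$ be a directed graph with vertex set $V=\{1,\dots,n\}$, let $\hat{\mathbf Q}=(\hat q_{ij})\in\hat{\mathbb U}^{n\times n}$ be a Hermitian matrix of unit dual quaternions, with $\hat q_{ij}$ the relative measurement for $(i,j)\in E$, and consider the two problems $$\text{(LS)}\quad \min_{\hat{\mathbf x}\in\hat{\mathbb U}^{n\times1}}\ \tfrac12\|P_E(\hat{\mathbf x}\hat{\mathbf x}^*-\hat{\mathbf Q})\|_F^2,\qquad\qquad \text{(AUX)}\quad \min_{\hat{\mathbf X}\in C_1\cap C_2}\ \tfrac12\|P_E(\hat{\mathbf X}-\hat{\mathbf Q})\|_F^2,$$ where $$C_1=\{\hat{\mathbf X}\in\hat{\mathbb Q}^{n\times n}:\hat{\mathbf X}=\hat{\mathbf X}^*,\ \hat x_{ij}\in\hat{\mathbb U},\ \hat x_{ii}=\hat1\},\qquad C_2=\{\hat{\mathbf X}\in\hat{\mathbb Q}^{n\times n}:\mathrm{rank}(\hat{\mathbf X})=1\}.$$ Then (LS) and (AUX) are equivalent in the following sense: (i) If $\hat{\mathbf x}$ is an optimal solution of (LS), then $\hat{\mathbf X}=\hat{\mathbf x}\hat{\mathbf x}^*$ is an optimal solution of (AUX). Furthermore, the optimal values of (LS) and (AUX) are the same. (ii) Let $\hat{\mathbf X}$ be an optimal solution of (AUX). Then its rank-one decomposition $\hat{\mathbf X}=\lambda\hat{\mathbf u}\hat{\mathbf u}^*$ (with $\lambda$ a dual number and $\hat{\mathbf u}^*\hat{\mathbf u}=\hat1$) satisfies $\lambda>0_D$.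 Furthermore, $\hat{\mathbf x}=\sqrt\lambda\,\hat{\mathbf u}$ is an optimal solution of (LS), and the optimal values of (LS) and (AUX) are the same.
   Context: Dual numbers: $a=a_{\mathrm{st}}+a_{\mathcal I}\epsilon$ with $a_{\mathrm{st}},a_{\mathcal I}\in\mathbb R$, $\epsilon\ne0$, $\epsilon^2=0$; $0_D=0+0\epsilon$; totally ordered by: $a>b$ iff $a_{\mathrm{st}}>b_{\mathrm{st}}$, or $a_{\mathrm{st}}=b_{\mathrm{st}}$ and $a_{\mathcal I}>b_{\mathcal I}$. Minimization of dual-number-valued functions is with respect to this order. If $a_{\mathrm{st}}>0$, $\sqrt a=\sqrt{a_{\mathrm{st}}}+\frac{a_{\mathcal I}}{2\sqrt{a_{\mathrm{st}}}}\epsilon$. $\mathbb Q$ is the set of real (Hamilton) quaternions, with conjugate $\tilde q^*$, magnitude $|\tilde q|$, scalar part $sc(\tilde q)=\frac12(\tilde q+\tilde q^* )$. Dual quaternions $\hat{\mathbb Q}$: $\hat q=\tilde q_{\mathrm{st}}+\tilde q_{\mathcal I}\epsilon$ with $\tilde q_{\mathrm{st}},\tilde q_{\mathcal I}\in\mathbb Q$, $\epsilon$ commuting with quaternions, $\hat q^*=\tilde q_{\mathrm{st}}^*+\tilde q_{\mathcal I}^*\epsilon$, $\hat 1=\tilde1+\tilde0\epsilon$. $\hat q$ is a unit dual quaternion ($\hat q\in\hat{\mathbb U}$) if $|\tilde q_{\mathrm{st}}|=1$ and $\tilde q_{\mathrm{st}}\tilde q_{\mathcal I}^*+\tilde q_{\mathcal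 I}\tilde q_{\mathrm{st}}^*=\tilde0$ (equivalently $\hat q^*\hat q=\hat 1$). $\hat{\mathbb U}^{m\times n}$ is the set of $m\times n$ matrices all of whose entries are unit dual quaternions. $\hat{\mathbf A}^*$ is the conjugate transpose; Hermitian means $\hat{\mathbf A}=\hat{\mathbf A}^*$. The $F$-norm of $\hat{\mathbf A}=\tilde{\mathbf A}_{\mathrm{st}}+\tilde{\mathbf A}_{\mathcal I}\epsilon$ is the dual number $\|\tilde{\mathbf A}_{\mathrm{st}}\|_F+\frac{sc(\mathrm{tr}(\tilde{\mathbf A}_{\mathrm{st}}^*\tilde{\mathbf A}_{\mathcal I}))}{\|\tilde{\mathbf A}_{\mathrm{st}}\|_F}\epsilon$ if $\tilde{\mathbf A}_{\mathrm{st}}\ne\mathbf O$, and $\|\tilde{\mathbf A}_{\mathcal I}\|_F\epsilon$ otherwise. $P_E(\hat{\mathbf A})$ keeps the entries of $\hat{\mathbf A}$ with index $(i,j)\in E$ and sets all others to zero. Rank: every dual quaternion Hermitian matrix can be written as $\hat{\mathbf X}=\sum_{i=1}^n\lambda_i\hat{\mathbf u}_i\hat{\mathbf u}_i^*$ with dual number eigenvalues $\lambda_i$ and orthonormal $\hat{\mathbf u}_i$; $\mathrm{rank}(\hat{\mathbf X})$ is the number of nonzero $\lambda_i$. So a Hermitian $\hat{\mathbf X}$ has rank one iff $\hat{\mathbf X}=\lambda\hat{\mathbf u}\hat{\mathbf u}^*$ with a nonzero dual number $\lambda$ and $\hat{\mathbf u}^*\hat{\mathbf u}=\hat1$ (its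 rank-one decomposition). Only the rank of Hermitian matrices matters here, since $C_1$ consists of Hermitian matrices. *)

(* Defs.v *)
From HB Require Import structures.
From mathcomp Require Import all_boot all_order all_algebra.
From mathcomp Require Import boolp classical_sets reals.
From mathcomp Require Import ring lra.

Set Implicit Arguments.
Unset Strict Implicit.
Unset Printing Implicit Defensive.

Import Order.TTheory GRing.Theory Num.Theory.
Local Open Scope ring_scope.

(* [Dual a b] is [a + b eps], where [eps ^+ 2 = 0].
   For [R] the reals, [dual R] is the ring of dual numbers; [dual (quat R)] is
   that of dual quaternions, in which [eps] is central. *)
Record dual (A : Type) := Dual { dst : A; dinf : A }.

Section DualRing.

Definition dual_pair (A : Type) (x : dual A) : A * A := (dst x, dinf x).
Definition dual_of_pair (A : Type) (p : A * A) : dual A := Dual p.1 p.2.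

Lemma dual_pairK (A : Type) : cancel (@dual_pair A) (@dual_of_pair A).
Proof. by case. Qed.

HB.instance Definition _ (A : choiceType) :=
  Choice.copy (dual A) (can_type (@dual_pairK A)).

Variable A : nzRingType.
Implicit Types x y z : dual A.

Definition dual_zero : dual A := Dual 0 0.
Definition dual_one : dual A := Dual 1 0.
Definition dual_opp x := Dual (- dst x) (- dinf x).
Definition dual_add x y := Dual (dst x + dst y) (dinf x + dinf y).
Definition dual_mul x y := Dual (dst x * dst y) (dst x * dinf y + dinf x * dst y).

Fact dual_addA : associative dual_add.
Proof. by move=> x y z; congr Dual; rewrite /= addrA. Qed.
Fact dual_addC : commutative dual_add.
Proof. by move=> x y; congr Dual; rewrite /= addrC. Qed.
Fact dual_add0 : left_id dual_zero dual_add.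
Proof. by case=> a b; congr Dual; rewrite /= add0r. Qed.
Fact dual_addN : left_inverse dual_zero dual_opp dual_add.
Proof. by move=> x; congr Dual; rewrite /= addNr. Qed.

HB.instance Definition _ :=
  GRing.isZmodule.Build (dual A) dual_addA dual_addC dual_add0 dual_addN.

Fact dual_mulA : associative dual_mul.
Proof.
move=> x y z; congr Dual; rewrite /= ?mulrA //.
by rewrite mulrDr mulrDl !mulrA addrA.
Qed.
Fact dual_mul1l : left_id dual_one dual_mul.
Proof. by case=> a b; congr Dual; rewrite /= ?mul0r ?addr0 mul1r. Qed.
Fact dual_mul1r : right_id dual_one dual_mul.
Proof. by case=> a b; congr Dual; rewrite /= ?mulr0 ?add0r mulr1. Qed.
Fact dual_mulDl : left_distributive dual_mul +%R.
Proof. by move=> x y z; congr Dual; rewrite /= !mulrDl // addrACA. Qed.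
Fact dual_mulDr : right_distributive dual_mul +%R.
Proof. by move=> x y z; congr Dual; rewrite /= !mulrDr // addrACA. Qed.
Fact dual_one_neq0 : dual_one != 0.
Proof. by apply/eqP => -[] /eqP; rewrite oner_eq0. Qed.

HB.instance Definition _ := GRing.Zmodule_isNzRing.Build (dual A)
  dual_mulA dual_mul1l dual_mul1r dual_mulDl dual_mulDr dual_one_neq0.

End DualRing.

Fact dual_display : Order.disp_t. Proof. exact: (Order.Disp tt tt). Qed.

Section DualOrder.
Variable R : realType.
Implicit Types a b c : dual R.

Definition dual_lt a b : bool :=
  (dst a < dst b) || ((dst a == dst b) && (dinf a < dinf b)).

Fact dual_lt_irr : irreflexive dual_lt.
Proof. by move=> a; rewrite /dual_lt !ltxx andbF. Qed.

Fact dual_lt_trans : transitive dual_lt.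
Proof.
move=> b a c /orP[ab|/andP[/eqP ab ab']] /orP[bc|/andP[/eqP bc bc']];
  apply/orP.
- by left; apply: lt_trans bc.
- by left; rewrite -bc.
- by left; rewrite ab.
- by right; rewrite ab bc eqxx (lt_trans ab' bc').
Qed.

HB.instance Definition _ :=
  Order.Lt_isPOrder.Build dual_display (dual R) dual_lt_irr dual_lt_trans.

Lemma dual_ltE a b : (a < b)%O = dual_lt a b.
Proof. by []. Qed.

Fact dual_le_total : total (<=%O : rel (dual R)).
Proof.
case=> [a b] [c d]; rewrite !le_eqVlt !dual_ltE /dual_lt /=.
case: (ltgtP a c) => [||->] /=; rewrite ?orbT //.
by case: (ltgtP b d) => [||->] /=; rewrite ?eqxx ?orbT.
Qed.

HB.instance Definition _ :=
  Order.POrder_isTotal.Build dual_display (dual R) dual_le_total.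

(* Meaningful only when [0 < dst a]. *)
Definition dual_sqrt a : dual R :=
  Dual (Num.sqrt (dst a)) (dinf a / (2%:R * Num.sqrt (dst a))).

End DualOrder.

(* [Quat a b c d] is [a + b i + c j + d k]. *)

Record quat (R : Type) := Quat { q0 : R; q1 : R; q2 : R; q3 : R }.

Section QuatRing.

Definition quat_tuple (R : Type) (p : quat R) := (q0 p, q1 p, q2 p, q3 p).
Definition quat_of_tuple (R : Type) (t : R * R * R * R) :=
  let: (a, b, c, d) := t in Quat a b c d.

Lemma quat_tupleK (R : Type) : cancel (@quat_tuple R) (@quat_of_tuple R).
Proof. by case. Qed.

HB.instance Definition _ (R : choiceType) :=
  Choice.copy (quat R) (can_type (@quat_tupleK R)).

Variable R : comNzRingType.
Implicit Types p q : quat R.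

Definition quat_real (a : R) : quat R := Quat a 0 0 0.
Definition quat_opp p := Quat (- q0 p) (- q1 p) (- q2 p) (- q3 p).
Definition quat_add p q :=
  Quat (q0 p + q0 q) (q1 p + q1 q) (q2 p + q2 q) (q3 p + q3 q).
Definition quat_mul p q := Quat
  (q0 p * q0 q - q1 p * q1 q - q2 p * q2 q - q3 p * q3 q)
  (q0 p * q1 q + q1 p * q0 q + q2 p * q3 q - q3 p * q2 q)
  (q0 p * q2 q - q1 p * q3 q + q2 p * q0 q + q3 p * q1 q)
  (q0 p * q3 q + q1 p * q2 q - q2 p * q1 q + q3 p * q0 q).
Definition quat_conj p := Quat (q0 p) (- q1 p) (- q2 p) (- q3 p).

Fact quat_addA : associative quat_add.
Proof. by move=> x y z; congr Quat; rewrite /= addrA. Qed.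
Fact quat_addC : commutative quat_add.
Proof. by move=> x y; congr Quat; rewrite /= addrC. Qed.
Fact quat_add0 : left_id (quat_real 0) quat_add.
Proof. by case=> a b c d; congr Quat; rewrite /= add0r. Qed.
Fact quat_addN : left_inverse (quat_real 0) quat_opp quat_add.
Proof. by move=> x; congr Quat; rewrite /= addNr. Qed.

HB.instance Definition _ :=
  GRing.isZmodule.Build (quat R) quat_addA quat_addC quat_add0 quat_addN.

Fact quat_mulA : associative quat_mul.
Proof. by move=> x y z; congr Quat; rewrite /=; ring. Qed.
Fact quat_mul1l : left_id (quat_real 1) quat_mul.
Proof. by case=> a b c d; congr Quat; rewrite /=; ring. Qed.
Fact quat_mul1r : right_id (quat_real 1) quat_mul.
Proof. by case=> a b c d; congr Quat; rewrite /=; ring. Qed.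
Fact quat_mulDl : left_distributive quat_mul +%R.
Proof. by move=> x y z; congr Quat; rewrite /=; ring. Qed.
Fact quat_mulDr : right_distributive quat_mul +%R.
Proof. by move=> x y z; congr Quat; rewrite /=; ring. Qed.
Fact quat_one_neq0 : quat_real 1 != 0.
Proof. by apply/eqP => -[] /eqP; rewrite oner_eq0. Qed.

HB.instance Definition _ := GRing.Zmodule_isNzRing.Build (quat R)
  quat_mulA quat_mul1l quat_mul1r quat_mulDl quat_mulDr quat_one_neq0.

End QuatRing.

Section Quaternions.
Variable R : realType.
Implicit Types p q : quat R.

Definition quat_norm q : R :=
  Num.sqrt (q0 q ^+ 2 + q1 q ^+ 2 + q2 q ^+ 2 + q3 q ^+ 2).

Definition sc q : R := q0 q.

Lemma scE q : quat_real (sc q) = quat_real 2^-1 * (q + quat_conj q).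
Proof. by case: q => a b c d; congr Quat; rewrite /sc /=; field. Qed.

End Quaternions.

Notation dquat R := (dual (quat R)).

Section DualQuaternions.
Variable R : realType.

Implicit Types q : dquat R.

Definition dquat_conj q : dquat R := Dual (quat_conj (dst q)) (quat_conj (dinf q)).

Definition dquat_of_dual (a : dual R) : dquat R :=
  Dual (quat_real (dst a)) (quat_real (dinf a)).

Definition unit_dquat q : Prop :=
  quat_norm (dst q) = 1 /\
  dst q * quat_conj (dinf q) + dinf q * quat_conj (dst q) = 0.

Definition quat_ctmx m n (A : 'M[quat R]_(m, n)) : 'M[quat R]_(n, m) :=
  map_mx (@quat_conj R) A^T.

Definition ctmx m n (A : 'M[dquat R]_(m, n)) : 'M[dquat R]_(n, m) :=
  map_mx dquat_conj A^T.

Definition hermitian_dqmx n (A : 'M[dquat R]_n) : Prop := A = ctmx A.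

Definition quat_normF m n (A : 'M[quat R]_(m, n)) : R :=
  Num.sqrt (\sum_i \sum_j quat_norm (A i j) ^+ 2).

Definition normF m n (A : 'M[dquat R]_(m, n)) : dual R :=
  let Ast := map_mx (@dst _) A in
  let Aim := map_mx (@dinf _) A in
  if Ast != 0 then
    Dual (quat_normF Ast) (sc (\tr (quat_ctmx Ast *m Aim)) / quat_normF Ast)
  else Dual 0 (quat_normF Aim).

Definition restrict_mx n (E : {set 'I_n * 'I_n}) (A : 'M[dquat R]_n) :
    'M[dquat R]_n :=
  \matrix_(i, j) if (i, j) \in E then A i j else 0.

Definition orthonormal_family n (u : 'I_n -> 'cV[dquat R]_n) : Prop :=
  forall i j, ctmx (u i) *m u j = ((i == j)%:R)%:M.

Definition spectral_decomposition n (X : 'M[dquat R]_n)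
    (lam : 'I_n -> dual R) (u : 'I_n -> 'cV[dquat R]_n) : Prop :=
  orthonormal_family u /\
  X = \sum_i dquat_of_dual (lam i) *: (u i *m ctmx (u i)).

(* Every Hermitian matrix has a spectral decomposition, and the number of
   nonzero eigenvalues does not depend on it.  A matrix with a spectral
   decomposition is Hermitian; the others get the junk value 0. *)
Definition rank n (X : 'M[dquat R]_n) : nat :=
  xget 0%N [set r | exists lam u,
    spectral_decomposition X lam u /\ #|[set i | lam i != 0]%SET| = r]%classic.

Definition rank_one_decomposition n (X : 'M[dquat R]_n)
    (lam : dual R) (u : 'cV[dquat R]_n) : Prop :=
  ctmx u *m u = 1%:M /\ X = dquat_of_dual lam *: (u *m ctmx u).

Definition optimal (T : Type) (S : set T) (f : T -> dual R) (x : T) : Prop :=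
  S x /\ forall y, S y -> (f x <= f y)%O.

Definition optimal_value (T : Type) (S : set T) (f : T -> dual R)
    (v : dual R) : Prop :=
  exists2 x, optimal S f x & f x = v.

Definition C1 n : set 'M[dquat R]_n :=
  [set X | [/\ hermitian_dqmx X, forall i j, unit_dquat (X i j)
             & forall i, X i i = 1]]%classic.

Definition C2 n : set 'M[dquat R]_n := [set X | rank X = 1%N]%classic.

Definition AUX_feasible n : set 'M[dquat R]_n := (@C1 n `&` @C2 n)%classic.

Definition AUX_objective n (E : {set 'I_n * 'I_n}) (Q X : 'M[dquat R]_n) : dual R :=
  Dual 2^-1 0 * normF (restrict_mx E (X - Q)) ^+ 2.

Definition LS_feasible n : set 'cV[dquat R]_n :=
  [set x | forall i, unit_dquat (x i ord0)]%classic.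

Definition LS_objective n (E : {set 'I_n * 'I_n}) (Q : 'M[dquat R]_n)
    (x : 'cV[dquat R]_n) : dual R :=
  Dual 2^-1 0 * normF (restrict_mx E (x *m ctmx x - Q)) ^+ 2.

End DualQuaternions.

Arguments AUX_feasible {R n}.
Arguments LS_feasible {R n}.

(* Main.v *)
Require Import Defs.
From HB Require Import structures.
From mathcomp Require Import all_boot all_order all_algebra.
From mathcomp Require Import boolp classical_sets reals.
From mathcomp Require Import ring.

Set Implicit Arguments.
Unset Strict Implicit.
Unset Printing Implicit Defensive.

Import Order.TTheory GRing.Theory Num.Theory.
Local Open Scope ring_scope.

(** The map [x |-> x *m ctmx x] sends the columns of unit dual quaternions onto
    the matrices with unit entries, unit diagonal and rank one, and the
    objective of (AUX) composed with it is the objective of (LS).  Minimizers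
    and minima of the two problems then correspond for purely order-theoretic
    reasons ([optimal_push], [optimal_pull], [optimal_value_transfer]), so the
    content is that the image is exactly the feasible set of (AUX).

    Into the feasible set ([outer_AUX_feasible]).  For [x] with unit entries,
    [X = x *m ctmx x] has trace [n] and satisfies [X *m X = n *: X].  Hence
    every eigenvalue [l] in any spectral decomposition of [X] satisfies
    [l * l = n * l], which over the dual numbers still forces [l = 0] or
    [l = n] because the standard part of [n] is nonzero; the eigenvalues sum to
    the trace [n], so exactly one of them is nonzero ([spectral_card]).  This
    shows at once that the rank is independent of the decomposition.  It
    remains to see that a decomposition exists, that is, to complete
    [x / sqrt n] to an orthonormal family.  Since
    [x / sqrt n = D *m (1, ..., 1)^T / sqrt n] with [D] the unitary diagonal
    matrix with diagonal [x], it is enough to complete the constant real unit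
    vector, which a Householder reflection does ([orthogonal_completion],
    [LS_feasible_spectral]).

    Onto the feasible set ([AUX_feasible_root]).  If [X = lam *: u *m ctmx u]
    has unit diagonal, then the standard part of [lam * |u_i|^2] is [1], so
    that of [lam] is positive.  Therefore [sqrt lam] squares to [lam],
    [x = sqrt lam *: u] satisfies [x *m ctmx x = X], and the diagonal of [X]
    says that the entries of [x] are units.  This holds for every rank-one
    decomposition of [X], which gives part (ii). *)

(** * Dual numbers inside the dual quaternions *)

Section DualQuaternionAlgebra.
Variable R : realType.
Implicit Types (a b : dual R) (p q : dquat R).

Lemma dquat_of_dual_is_zmod : zmod_morphism (@dquat_of_dual R).
Proof. by move=> a b; congr Dual; congr Quat; rewrite /= ?subr0. Qed.

Lemma dquat_of_dual_is_monoid : monoid_morphism (@dquat_of_dual R).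
Proof.
split; first by [].
by move=> a b; congr Dual; congr Quat; rewrite /=; ring.
Qed.

HB.instance Definition _ := GRing.isZmodMorphism.Build (dual R) (dquat R)
  (@dquat_of_dual R) dquat_of_dual_is_zmod.
HB.instance Definition _ := GRing.isMonoidMorphism.Build (dual R) (dquat R)
  (@dquat_of_dual R) dquat_of_dual_is_monoid.

Definition dual_real (r : R) : dual R := Dual r 0.

Lemma dual_real_is_zmod : zmod_morphism dual_real.
Proof. by move=> a b; congr Dual; rewrite /= subr0. Qed.

Lemma dual_real_is_monoid : monoid_morphism dual_real.
Proof. by split=> // a b; congr Dual; rewrite /= mulr0 mul0r addr0. Qed.

HB.instance Definition _ := GRing.isZmodMorphism.Build R (dual R)
  dual_real dual_real_is_zmod.
HB.instance Definition _ := GRing.isMonoidMorphism.Build R (dual R)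
  dual_real dual_real_is_monoid.

Lemma dquat_of_dual_inj : injective (@dquat_of_dual R).
Proof. by move=> [a a'] [b b'] [-> ->]. Qed.

Lemma dquat_of_dualC a q : dquat_of_dual a * q = q * dquat_of_dual a.
Proof.
by case: q => [[? ? ? ?] [? ? ? ?]]; congr Dual; congr Quat; rewrite /=; ring.
Qed.

Lemma dquat_conj_dual a : dquat_conj (dquat_of_dual a) = dquat_of_dual a.
Proof. by rewrite /dquat_conj /dquat_of_dual /quat_conj /= !oppr0. Qed.

Lemma dquat_conjM p q : dquat_conj (p * q) = dquat_conj q * dquat_conj p.
Proof. by congr Dual; congr Quat; rewrite /=; ring. Qed.

Lemma dquat_conjK : involutive (@dquat_conj R).
Proof.
by case=> [[? ? ? ?] [? ? ? ?]]; rewrite /dquat_conj /quat_conj /= !opprK.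
Qed.

(** Both products are the squared norm of [q]; this commutation is what replaces
    commutativity in the trace computations below. *)
Lemma dquat_conjC q : dquat_conj q * q = q * dquat_conj q.
Proof. by congr Dual; congr Quat; rewrite /=; ring. Qed.

(** The factor 2 in the infinitesimal part comes from polarizing the squared
    Euclidean norm of [dst q] in the direction [dinf q]. *)
Definition dquat_normsq q : dual R :=
  Dual (quat_norm (dst q) ^+ 2)
       (2 * (q0 (dst q) * q0 (dinf q) + q1 (dst q) * q1 (dinf q) +
             q2 (dst q) * q2 (dinf q) + q3 (dst q) * q3 (dinf q))).

Lemma quat_norm_sqr (q : quat R) :
  quat_norm q ^+ 2 = q0 q ^+ 2 + q1 q ^+ 2 + q2 q ^+ 2 + q3 q ^+ 2.
Proof. by rewrite sqr_sqrtr // !addr_ge0 // sqr_ge0. Qed.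

Lemma dquat_mul_conj q : q * dquat_conj q = dquat_of_dual (dquat_normsq q).
Proof.
congr Dual; congr Quat; rewrite /= ?quat_norm_sqr; ring.
Qed.

Lemma unit_dquatP q : unit_dquat q <-> q * dquat_conj q = 1.
Proof.
split=> [[nq orth]|eq1].
  congr Dual; last exact: orth.
  have := quat_norm_sqr (dst q); rewrite nq expr1n => e.
  by congr Quat; rewrite /= ?e; ring.
split; last exact: (congr1 (@dinf _) eq1).
have : quat_norm (dst q) ^+ 2 == 1.
  move: eq1; rewrite dquat_mul_conj => /(congr1 (fun p => q0 (dst p))) /= nq.
  exact/eqP.
by rewrite -[X in _ == X](expr1n _ 2) eqrXn2 // ?sqrtr_ge0 // => /eqP.
Qed.

(** Dual numbers have zero divisors, so [a * (a - c) = 0] does not split by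
    itself; it does when [dst c != 0], because [dst a] and [dst (a - c)] are then
    not both zero, and a dual number with nonzero standard part is regular. *)
Lemma dual_sqr_eq_scale (a c : dual R) :
  dst c != 0 -> a * a = c * a -> a = 0 \/ a = c.
Proof.
case: a c => [a a'] [c c'] /= c0 [e1 e2].
have [a0|a0] := eqVneq a 0.
  left; congr Dual => //; move: e2; rewrite a0 mul0r !mulr0 !addr0.
  by move/esym/eqP; rewrite mulf_eq0 (negPf c0) => /eqP.
right; have ac : a = c by apply: (mulIf a0); exact: e1.
by congr Dual => //; apply: (mulIf a0); move: e2; rewrite -ac => /addrI.
Qed.

Lemma dual_sqrtK (a : dual R) : 0 < dst a -> dual_sqrt a * dual_sqrt a = a.
Proof.
case: a => a b /= a0; have s0 : Num.sqrt a != 0 by rewrite gt_eqF ?sqrtr_gt0.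
congr Dual; rewrite /= -?expr2 ?sqr_sqrtr ?ltW //.
by field.
Qed.

Lemma unit_dquat_conj_mul (q : dquat R) : unit_dquat q -> dquat_conj q * q = 1.
Proof. by rewrite dquat_conjC => /unit_dquatP. Qed.

End DualQuaternionAlgebra.

(** * Spectral decompositions and rank one *)

Section DualQuaternionMatrices.
Variable R : realType.

Lemma ctmx_mul m n p (A : 'M[dquat R]_(m, n)) (B : 'M_(n, p)) :
  ctmx (A *m B) = ctmx B *m ctmx A.
Proof.
apply/matrixP => i j; rewrite !mxE.
have conj_sum (I : finType) (F : I -> dquat R) :
    dquat_conj (\sum_k F k) = \sum_k dquat_conj (F k).
  apply: (big_morph (@dquat_conj R)) => [p1 p2|].
    by congr Dual; congr Quat; rewrite /= opprD.
  exact: (dquat_conj_dual (0 : dual R)).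
by rewrite conj_sum; apply: eq_bigr => k _; rewrite !mxE dquat_conjM.
Qed.

Lemma ctmxK m n (A : 'M[dquat R]_(m, n)) : ctmx (ctmx A) = A.
Proof. by apply/matrixP => i j; rewrite !mxE dquat_conjK. Qed.

Lemma ctmxZ m n (a : dual R) (A : 'M[dquat R]_(m, n)) :
  ctmx (dquat_of_dual a *: A) = dquat_of_dual a *: ctmx A.
Proof.
by apply/matrixP => i j; rewrite !mxE dquat_conjM dquat_conj_dual dquat_of_dualC.
Qed.

Lemma mulmx_dualZr m n p (a : dual R) (A : 'M[dquat R]_(m, n)) (B : 'M_(n, p)) :
  A *m (dquat_of_dual a *: B) = dquat_of_dual a *: (A *m B).
Proof.
apply/matrixP => i j; rewrite !mxE big_distrr /=; apply: eq_bigr => k _.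
by rewrite !mxE !mulrA dquat_of_dualC.
Qed.

(** The trace is not cyclic over a noncommutative ring; this instance survives
    because each [q] commutes with its conjugate. *)
Lemma mxtrace_outer n (u : 'cV[dquat R]_n) :
  \tr (u *m ctmx u) = (ctmx u *m u) ord0 ord0.
Proof.
rewrite mxE; apply: eq_bigr => k _.
by rewrite !mxE big_ord1 !mxE dquat_conjC.
Qed.

Lemma outerE n (x : 'cV[dquat R]_n) i j :
  (x *m ctmx x) i j = x i ord0 * dquat_conj (x j ord0).
Proof. by rewrite mxE big_ord1 !mxE. Qed.

Lemma outer_eigen n (x : 'cV[dquat R]_n) (c : dual R) :
  ctmx x *m x = (dquat_of_dual c)%:M ->
  (x *m ctmx x) *m (x *m ctmx x) = dquat_of_dual c *: (x *m ctmx x).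
Proof.
move=> xx; rewrite mulmxA -(mulmxA x) xx.
by rewrite -scalemx1 mulmx_dualZr mulmx1 scalemxAl.
Qed.

(** A column of unit length is a regular vector for dual scalars, although some
    nonzero dual scalars are zero divisors. *)
Lemma dual_scale_inj n (u : 'cV[dquat R]_n) :
  ctmx u *m u = 1%:M -> injective (fun a => dquat_of_dual a *: u).
Proof.
move=> uu a b /= ab; apply: dquat_of_dual_inj.
have e c : (ctmx u *m (dquat_of_dual c *: u)) ord0 ord0 = dquat_of_dual c.
  by rewrite (mulmx_dualZr c (ctmx u) u) uu !mxE eqxx mulr1.
by rewrite -(e a) ab e.
Qed.

Lemma spectral_eigen n (X : 'M[dquat R]_n) lam u j :
  spectral_decomposition X lam u -> X *m u j = dquat_of_dual (lam j) *: u j.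
Proof.
case=> ortho ->; rewrite mulmx_suml (bigD1 j) //= big1 ?addr0.
  by rewrite -scalemxAl -mulmxA ortho eqxx mulmx1.
move=> i /negPf ij.
by rewrite -scalemxAl -mulmxA ortho ij raddf0 mulmx0 scaler0.
Qed.

Lemma orthonormal_trace n (u : 'I_n -> 'cV[dquat R]_n) j :
  orthonormal_family u -> \tr (u j *m ctmx (u j)) = 1.
Proof. by move=> ortho; rewrite mxtrace_outer ortho eqxx mxE eqxx. Qed.

(** A matrix with [X *m X = c *: X] can only have the eigenvalues [0] and [c], so
    its trace is [c] times the number of nonzero eigenvalues. *)
Lemma spectral_card n (X : 'M[dquat R]_n) (c : R) lam u :
  c != 0 -> \tr X = dquat_of_dual (dual_real c) ->
  X *m X = dquat_of_dual (dual_real c) *: X ->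
  spectral_decomposition X lam u -> #|[set i | lam i != 0]%SET| = 1%N.
Proof.
move=> c0 trX XX dec; have [ortho defX] := dec.
have lam2 j : lam j = 0 \/ lam j = dual_real c.
  apply: dual_sqr_eq_scale => //.
  have uu : ctmx (u j) *m u j = 1%:M by rewrite ortho eqxx.
  apply: (dual_scale_inj uu); rewrite !rmorphM -!scalerA.
  have Xu := spectral_eigen j dec.
  transitivity (X *m X *m u j); last by rewrite XX -scalemxAl Xu.
  by rewrite -mulmxA Xu mulmx_dualZr Xu.
have : \tr X = dquat_of_dual (\sum_j lam j).
  rewrite defX raddf_sum rmorph_sum /=; apply: eq_bigr => j _.
  by rewrite mxtraceZ orthonormal_trace // mulr1.
rewrite trX => /dquat_of_dual_inj.
rewrite (bigID (fun j => lam j != 0)) /= [X in _ + X]big1 ?addr0; last first.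
  by move=> j /negbNE/eqP.
rewrite (eq_bigr (fun=> dual_real c)); last first.
  by move=> j; case: (lam2 j) => -> //; rewrite eqxx.
rewrite sumr_const -rmorphMn => -[] /esym.
rewrite -mulr_natr -[X in _ = X]mulr1 => /(mulfI c0) /eqP.
by rewrite pnatr_eq1 cardsE => /eqP.
Qed.

(** The value picked in the definition of [rank] comes from some unknown
    decomposition; it is pinned down because [spectral_card] applies to all. *)
Lemma rank_eq1 n (X : 'M[dquat R]_n) (c : R) lam u :
  c != 0 -> \tr X = dquat_of_dual (dual_real c) ->
  X *m X = dquat_of_dual (dual_real c) *: X ->
  spectral_decomposition X lam u -> rank X = 1%N.
Proof.
move=> c0 trX XX dec; rewrite /rank.
case: xgetP => [r -> [l [v [dec' <-]]]|/(_ 1%N)].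
  exact: spectral_card c0 trX XX dec'.
by case; exists lam, u; split=> //; exact: spectral_card c0 trX XX dec.
Qed.

(** The default value [0] of [rank] differs from [1], so rank one does provide a
    spectral decomposition, with a single nonzero term. *)
Lemma rank1_decomposition n (X : 'M[dquat R]_n) :
  rank X = 1%N -> exists lam u, rank_one_decomposition X lam u.
Proof.
rewrite /rank; case: xgetP => // r -> [lam [u [[ortho defX] card1]]] r1.
rewrite r1 in card1; move/eqP/cards1P: card1 => [i0 Si0].
exists (lam i0), (u i0); split; first by rewrite ortho eqxx.
rewrite {1}defX (bigD1 i0) //= big1 ?addr0 // => i.
rewrite -finset.in_set1 -Si0 inE negbK => /eqP ->.
by rewrite rmorph0 scale0r.
Qed.

End DualQuaternionMatrices.

(** * Completion of a real unit vector *)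

(** The matrix is, up to sign, the Householder reflection exchanging [e] and
    [-v], where [e] is the basis vector of index [i0].  Reflecting along
    [w = e + v] rather than [e - v] keeps [w] nonzero when [v = e]: its squared
    length [2 * (1 + v_i0)] is positive since [v_i0] is nonnegative. *)
Lemma orthogonal_completion (F : realFieldType) n (v : 'cV[F]_n) (i0 : 'I_n) :
  v^T *m v = 1%:M -> 0 <= v i0 ord0 ->
  exists H : 'M[F]_n, H^T *m H = 1%:M /\ col i0 H = v.
Proof.
move=> vv v0; set e : 'cV[F]_n := delta_mx i0 ord0.
pose s := v i0 ord0; pose w := e + v.
have s1 : 1 + s != 0 by rewrite lt0r_neq0 // ltr_pwDl.
have ev : e^T *m v = s%:M.
  by rewrite trmx_delta -rowE; apply/matrixP => i j; rewrite !ord1 !mxE.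
have ww : w^T *m w = (2 * (1 + s))%:M.
  have ve : v^T *m e = s%:M.
    by rewrite -[v^T *m e]trmxK trmx_mul trmxK ev tr_scalar_mx.
  have ee : e^T *m e = 1%:M.
    rewrite trmx_delta mul_delta_mx; apply/matrixP => i j.
    by rewrite !ord1 !mxE !eqxx.
  have -> : w^T = e^T + v^T by rewrite /w linearD.
  rewrite /w mulmxDl !mulmxDr ev ve ee vv -!raddfD.
  by congr _%:M; ring.
pose H := (1 + s)^-1 *: (w *m w^T) - 1%:M.
have symH : H^T = H.
  by rewrite /H linearB /= linearZ /= trmx_mul trmxK trmx1.
exists H; split.
  rewrite symH /H mulmxBl mulmxBr mul1mx mulmx1 -scalemxAl -scalemxAr scalerA.
  rewrite mulmxA -(mulmxA w) ww mul_mx_scalar -scalemxAl scalerA.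
  have -> : (1 + s)^-1 * (1 + s)^-1 * (2 * (1 + s)) = 2 * (1 + s)^-1.
    by field.
  rewrite -scalerA scaler_nat mulr2n; set A := _ *: _.
  by rewrite addrK opprB addrC subrK.
have we : w^T *m e = (1 + s)%:M.
  apply/matrixP => i j; rewrite -colE !ord1 !mxE !eqxx //.
rewrite colE -/e /H mulmxBl mul1mx -scalemxAl -mulmxA we mul_mx_scalar scalerA.
by rewrite mulVf // scale1r /w addrC addKr.
Qed.

(** * Unit columns and the feasible set of the rank-one problem *)

Section UnitColumns.
Variable R : realType.

Lemma LS_feasible_normsq n (x : 'cV[dquat R]_n) :
  LS_feasible x -> ctmx x *m x = (dquat_of_dual (dual_real n%:R))%:M.
Proof.
move=> xU; apply/matrixP => i j; rewrite !ord1 !mxE eqxx mulr1n !rmorph_nat.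
rewrite (eq_bigr (fun=> 1)) ?sumr_const ?card_ord // => k _.
by rewrite !mxE unit_dquat_conj_mul //; apply: xU.
Qed.

(** Scaling row [i] of a real orthogonal matrix by the unit [x_i] keeps its
    columns orthonormal.  Starting from an orthogonal matrix whose first column
    is constant, the first column becomes [x / sqrt n], the eigenvector of
    [x *m ctmx x] for the eigenvalue [n]. *)
Lemma LS_feasible_spectral n (hn : (0 < n)%N) (x : 'cV[dquat R]_n) :
  LS_feasible x -> exists lam u, spectral_decomposition (x *m ctmx x) lam u.
Proof.
move=> xU; pose i0 := Ordinal hn; pose s : R := (Num.sqrt n%:R)^-1.
have ns2 : n%:R * (s * s) = 1.
  rewrite -expr2 exprVn sqr_sqrtr ?ler0n // mulfV // pnatr_eq0 -lt0n //.
pose real (r : R) : dquat R := dquat_of_dual (dual_real r).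
have [||H [HH Hi0]] := @orthogonal_completion R n (const_mx s) i0.
- apply/matrixP => i j; rewrite !ord1 !mxE eqxx (eq_bigr (fun=> s * s)).
    by rewrite sumr_const card_ord -mulr_natl.
  by move=> k _; rewrite !mxE.
- by rewrite mxE invr_ge0 sqrtr_ge0.
exists (fun i => if i == i0 then dual_real n%:R else 0).
exists (fun j => \col_i (x i ord0 * real (H i j))); split.
  move=> j k; apply/matrixP => a b; rewrite !ord1 !mxE eqxx mulr1n.
  have -> : (j == k)%:R = real ((H^T *m H) j k) by rewrite HH mxE /real !rmorph_nat.
  rewrite mxE /real !rmorph_sum; apply: eq_bigr => i _.
  rewrite !mxE dquat_conjM dquat_conj_dual -mulrA (mulrA (dquat_conj _)).
  by rewrite unit_dquat_conj_mul ?mul1r ?rmorphM //; apply: xU.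
rewrite (bigD1 i0) //= big1 ?addr0; last first.
  by move=> i /negPf ->; rewrite rmorph0 scale0r.
apply/matrixP => i j; rewrite outerE [RHS]mxE outerE !mxE.
have Hs k : H k i0 = s by have /matrixP/(_ k ord0) := Hi0; rewrite !mxE.
rewrite !Hs dquat_conjM dquat_conj_dual -/(real _) -/(real n%:R).
rewrite -(mulrA (x i ord0)) (mulrA (real s)) mulrA [real n%:R * _]dquat_of_dualC.
rewrite -mulrA (mulrA (real n%:R)) /real -!rmorphM /=.
by rewrite ns2 !rmorph1 mul1r.
Qed.

Lemma outer_AUX_feasible n (hn : (0 < n)%N) (x : 'cV[dquat R]_n) :
  LS_feasible x -> AUX_feasible (x *m ctmx x).
Proof.
move=> xU; have xx := LS_feasible_normsq xU.
have unit i : x i ord0 * dquat_conj (x i ord0) = 1 by apply/unit_dquatP/xU.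
have unit' i := unit_dquat_conj_mul (xU i).
split.
  split.
  - by rewrite /hermitian_dqmx ctmx_mul ctmxK.
  - move=> i j; apply/unit_dquatP; rewrite outerE dquat_conjM dquat_conjK.
    by rewrite mulrA -(mulrA (x i ord0)) unit' mulr1.
  - by move=> i; rewrite outerE unit.
have [lam [u dec]] := LS_feasible_spectral hn xU.
apply: (@rank_eq1 _ _ _ n%:R _ _ _ _ _ dec).
- by rewrite pnatr_eq0 -lt0n.
- by rewrite mxtrace_outer xx mxE eqxx.
- exact: outer_eigen.
Qed.

(** One diagonal entry suffices: [1 = X_ii = lam * |u_i|^2], and the standard
    part of [|u_i|^2] is a nonnegative real. *)
Lemma rank1_diag_gt0 n (X : 'M[dquat R]_n) lam (u : 'cV_n) (i : 'I_n) :
  X i i = 1 -> X = dquat_of_dual lam *: (u *m ctmx u) -> 0 < dst lam.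
Proof.
move=> Xii defX.
have := Xii; rewrite defX mxE outerE dquat_mul_conj -rmorphM.
move=> /(congr1 (fun q => q0 (dst q))) /= e.
rewrite ltNge; apply/negP => le0.
have := ler_wnM2r _ le0.
have : dst lam * quat_norm (dst (u i ord0)) ^+ 2 <= 0.
  by rewrite mulr_le0_ge0 // sqr_ge0.
by rewrite e ler10.
Qed.

Lemma rank_one_root n (X : 'M[dquat R]_n) lam (u : 'cV_n) :
  0 < dst lam -> X = dquat_of_dual lam *: (u *m ctmx u) ->
  let x := dquat_of_dual (dual_sqrt lam) *: u in x *m ctmx x = X.
Proof.
move=> lam0 -> /=.
by rewrite ctmxZ -scalemxAl mulmx_dualZr scalerA -rmorphM dual_sqrtK.
Qed.

Lemma outer_LS_feasible n (x : 'cV[dquat R]_n) :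
  (forall i, (x *m ctmx x) i i = 1) -> LS_feasible x.
Proof. by move=> x1 i; apply/unit_dquatP; rewrite -outerE. Qed.

Lemma AUX_feasible_root n (hn : (0 < n)%N) (X : 'M[dquat R]_n) lam u :
  AUX_feasible X -> rank_one_decomposition X lam u ->
  let x := dquat_of_dual (dual_sqrt lam) *: u in
  [/\ 0 < dst lam, LS_feasible x & x *m ctmx x = X].
Proof.
move=> [[_ _ X1] _] [_ defX] x.
have lam0 : 0 < dst lam := rank1_diag_gt0 (X1 (Ordinal hn)) defX.
have xX := rank_one_root lam0 defX.
by split=> //; apply: outer_LS_feasible => i; rewrite xX.
Qed.

End UnitColumns.

(** * Transfer of minimizers along a surjection *)

Section OptimalTransfer.
Variables (R : realType) (S T : Type) (A : set S) (B : set T).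
Variables (f : S -> dual R) (g : T -> dual R) (h : S -> T).
Hypothesis fh : forall x, f x = g (h x).
Hypothesis hAB : forall x, A x -> B (h x).
Hypothesis hsurj : forall y, B y -> exists2 x, A x & h x = y.

Lemma optimal_push x : optimal A f x -> optimal B g (h x).
Proof.
move=> [Ax min]; split; first exact: hAB.
by move=> _ /hsurj[z Az <-]; rewrite -!fh; apply: min.
Qed.

Lemma optimal_pull x : A x -> optimal B g (h x) -> optimal A f x.
Proof.
by move=> Ax [_ min]; split=> // z Az; rewrite !fh; apply/min/hAB.
Qed.

Lemma optimal_value_transfer v : optimal_value A f v <-> optimal_value B g v.
Proof.
split=> [[x xo <-]|[y yo <-]].
  by exists (h x); [apply: optimal_push | rewrite fh].
have [x Ax hx] := hsurj (proj1 yo).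
by exists x; [apply: optimal_pull; rewrite ?hx | rewrite fh hx].
Qed.

End OptimalTransfer.

(** * Equivalence of the two problems *)

Theorem theorem6p1 (R : realType) (n : nat) (hn : (0 < n)%N)
    (E : {set 'I_n * 'I_n}) (Q : 'M[dquat R]_n)
    (hQherm : hermitian_dqmx Q) (hQunit : forall i j, unit_dquat (Q i j)) :
  ((forall x : 'cV[dquat R]_n,
      optimal LS_feasible (LS_objective E Q) x ->
      optimal AUX_feasible (AUX_objective E Q) (x *m ctmx x)) /\
   (forall v : dual R,
      optimal_value LS_feasible (LS_objective E Q) v <->
      optimal_value AUX_feasible (AUX_objective E Q) v))
  /\
  ((forall X : 'M[dquat R]_n,
      optimal AUX_feasible (AUX_objective E Q) X ->
      (exists (lam : dual R) (u : 'cV[dquat R]_n),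
         rank_one_decomposition X lam u) /\
      (forall (lam : dual R) (u : 'cV[dquat R]_n),
         rank_one_decomposition X lam u ->
         ((0 : dual R) < lam)%O /\
         optimal LS_feasible (LS_objective E Q)
           (dquat_of_dual (dual_sqrt lam) *: u))) /\
   (forall v : dual R,
      optimal_value LS_feasible (LS_objective E Q) v <->
      optimal_value AUX_feasible (AUX_objective E Q) v)).
Proof.
pose h (x : 'cV[dquat R]_n) := x *m ctmx x.
have fh x : LS_objective E Q x = AUX_objective E Q (h x) by [].
have hAB x : LS_feasible x -> AUX_feasible (h x).
  exact: outer_AUX_feasible.
have hsurj X : AUX_feasible X -> exists2 x, LS_feasible x & h x = X.
  move=> XF; have [lam [u dec]] := rank1_decomposition (proj2 XF).
  have [_ xF xX] := AUX_feasible_root hn XF dec.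
  by exists (dquat_of_dual (dual_sqrt lam) *: u).
have values := optimal_value_transfer fh hAB hsurj.
split; split; [|exact: values| |exact: values].
  by move=> x; apply: (optimal_push fh hAB hsurj).
move=> X Xopt; split; first exact: rank1_decomposition (proj2 (proj1 Xopt)).
move=> lam u dec.
have [lam0 xF xX] := AUX_feasible_root hn (proj1 Xopt) dec.
split; first by rewrite dual_ltE /dual_lt lam0.
by apply: (optimal_pull fh hAB xF); rewrite /h xX.
Qed.
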